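(* Let $\alpha>0$, $L>0$, and let $\mathcal{H}$ be an infinite dimensional Hilbert space with fixed orthonormal basis $\{|e_0\rangle,|e_1\rangle,\dots\}$. Consider the i.i.d. quantum model $\mathcal{Q}_n=\{|\psi\rangle\langle\psi|^{\otimes n}:|\psi\rangle\langle\psi|\in S^\alpha(L)\}$. There exists a constant $c>0$ depending only on $\alpha$ and $L$ such that $$\liminf_{n\to\infty}\ \inf_{|\widehat\psi_n\rangle}\ \sup_{|\psi\rangle\in S^\alpha(L)} n^{2\alpha/(2\alpha+1)}\,\mathbb{E}_\rho\left[d^2(\widehat\rho_n,\rho)\right]\ge c,$$ where $\rho=|\psi\rangle\langle\psi|$, the infimum is taken over all estimators $\widehat\rho_n=|\widehat\psi_n\rangle\langle\widehat\psi_n|$ (defined by a combination of a measurement and a classical estimator), and the loss function $d(\widehat\rho_n,\rho)$ is either the norm-one distance or the Bures distance.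
   Context: The Hermite-Sobolev class is $S^\alpha(L)=\{|\psi\rangle\langle\psi|:\ \sum_{j=0}^\infty|\psi_j|^2j^{2\alpha}\le L,\ \|\psi\|=1\}$, where $\psi_j=\langle e_j|\psi\rangle$. Writing $|\psi\rangle\in S^\alpha(L)$ means $|\psi\rangle\langle\psi|\in S^\alpha(L)$. An estimator is the (random) result of a quantum measurement on $\rho^{\otimes n}$ followed by a classical estimator, i.e. the outcome of a positive operator valued measure $M$ on $\mathcal{H}^{\otimes n}$ ($M(E)\ge0$, $\sigma$-additive, total mass $\mathbf 1$), possibly processed by a classical map, with values in the pure states of $\mathcal{H}$; the outcome of $M$ has law $E\mapsto\mathrm{Tr}(\rho^{\otimes n}M(E))$ and $\mathbb{E}_\rho$ is the corresponding expectation. The norm-one (trace-norm) distance is $\|\rho-\rho'\|_1=\mathrm{Tr}|\rho-\rho'|$, and the Bures distance $d_b$ is given by $d_b^2(\rho,\rho')=2\big(1-\mathrm{Tr}\sqrt{\sqrt{\rho}\rho'\sqrt{\rho}}\big)$. For pure states $\rho=|\psi\rangle\langle\psi|$, $\rho'=|\psi'\rangle\langle\psi'|$ these equal $2\sqrt{1-|\langle\psi|\psi'\rangle|^2}$ and $d_b^2=2(1-|\langle\psi|\psi'\rangle|)$ respectively. *)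

(* Defs.v *)
From HB Require Import structures.
From mathcomp Require Import all_boot all_order all_algebra.
From mathcomp Require Import sesquilinear complex.
From mathcomp Require Import all_classical all_reals all_analysis.
From mathcomp Require summability.
Import Order.TTheory GRing.Theory Num.Theory numFieldNormedType.Exports.
Import ComplexField.Normc.

Set Implicit Arguments.
Unset Strict Implicit.
Unset Printing Implicit Defensive.

Local Open Scope classical_set_scope.
Local Open Scope complex_scope.
Local Open Scope ring_scope.

Record preHilbert (R : realType) := PreHilbert {
  carrier :> lmodType R[i] ;
  hdot : {dot carrier for @Num.conj R[i]} }.

(* [hdot] is linear in its first argument, the bra-ket in its second one. *)
Definition braket (R : realType) (H : preHilbert R) (u v : H) : R[i] :=
  @hdot R H v u.

Definition hnorm (R : realType) (H : preHilbert R) (u : H) : R :=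
  Num.sqrt (complex.Re (braket u u)).

Definition hcomplete (R : realType) (H : preHilbert R) : Prop :=
  forall u : nat -> H,
    (forall eps : R, 0 < eps -> exists N : nat, forall m n : nat,
       (N <= m)%N -> (N <= n)%N -> hnorm (u m - u n) < eps) ->
    exists l : H, (fun n => hnorm (u n - l)) @ \oo --> (0 : R).

Record hilbert (R : realType) := Hilbert {
  hspace :> preHilbert R ;
  hilbert_complete : hcomplete hspace }.

Definition dense_span (R : realType) (H : preHilbert R) (I : Type)
    (b : I -> H) : Prop :=
  forall (u : H) (eps : R), 0 < eps ->
    exists (s : seq I) (c : I -> R[i]),
      hnorm (u - \sum_(i <- s) c i *: b i) < eps.

Definition orthonormal_basis (R : realType) (H : preHilbert R) (I : eqType)
    (b : I -> H) : Prop :=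
  (forall i j, braket (b i) (b j) = (i == j)%:R) /\ dense_span b.

Section operators.
Context {R : realType} {H : preHilbert R}.
Implicit Types (A B : H -> H) (u v psi : H).

Definition bounded_op A : Prop :=
  linear A /\ exists C : R, forall u, hnorm (A u) <= C * hnorm u.

(* The order of [R[i]] makes [0 <= z] say that [z] is real and nonnegative. *)
Definition positive_op A : Prop := forall u, 0 <= braket u (A u).

Definition ketbra psi : H -> H := fun u => braket psi u *: psi.

(* Choices by [xget] below are junk (the zero operator) when no operator has
   the required property; the operator is unique when there is one. *)
Definition adjoint A : H -> H :=
  xget (fun _ => 0) [set B | forall u v, braket (A u) v = braket u (B v)].

Definition sqrt_op A : H -> H :=
  xget (fun _ => 0) [set B | [/\ bounded_op B, positive_op B & B \o B = A]].

Definition abs_op A : H -> H := sqrt_op (adjoint A \o A).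

(* Unordered sum of the diagonal entries in the orthonormal basis [b]. *)
Definition trace (I : choiceType) (b : I -> H) A : R[i] :=
  @summability.sum I R[i] (R[i]^o) (fun i => braket (b i) (A (b i))).

Definition pure_states : set (H -> H) :=
  [set rho | exists psi, hnorm psi = 1 /\ rho = ketbra psi].

Definition trace_dist (I : choiceType) (b : I -> H) (rho sigma : H -> H) : R :=
  complex.Re (trace b (abs_op (rho \- sigma))).

Definition bures_dist (I : choiceType) (b : I -> H) (rho sigma : H -> H) : R :=
  Num.sqrt (2 * (1 - complex.Re
    (trace b (sqrt_op (sqrt_op rho \o sigma \o sqrt_op rho))))).

(* Borel sets of the pure states, the topology being the trace-norm one. *)
Definition open_pure (I : choiceType) (b : I -> H) (U : set (H -> H)) : Prop :=
  U `<=` pure_states /\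
  forall rho, U rho -> exists2 eps : R, 0 < eps &
    forall sigma, pure_states sigma -> trace_dist b rho sigma < eps -> U sigma.

Definition borel_pure (I : choiceType) (b : I -> H) : set (set (H -> H)) :=
  <<s pure_states, open_pure b >>.

Definition sobolev (e : nat -> H) (alpha L : R) : set (H -> H) :=
  [set rho | exists psi,
    [/\ rho = ketbra psi,
        (\sum_(0 <= j <oo)
           (normc (braket (e j) psi) ^+ 2 * (j%:R `^ (2 * alpha)))%:E
         <= L%:E)%E
      & hnorm psi = 1]].

(* Countable additivity is required weakly, i.e. entry by entry. *)
Definition povm (d : measure_display) (T : measurableType d)
    (M : set T -> H -> H) : Prop :=
  [/\ forall E, measurable E -> bounded_op (M E) /\ positive_op (M E),
      forall F : nat -> set T, (forall k, measurable (F k)) ->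
        trivIset setT F -> forall u v,
        (fun m => normc (\sum_(0 <= k < m) braket u (M (F k) v)
                         - braket u (M (\bigcup_k F k) v))) @ \oo --> (0 : R)
    & M setT = id].

End operators.

Definition upd (T : Type) (n : nat) (u : 'I_n -> T) (i : 'I_n) (x : T) :
    'I_n -> T := fun j => if j == i then x else u j.

(* The Hilbert space [n]-th tensor power, characterised (up to a unique
   isomorphism) by its universal multilinear map. *)
Record tensor_power (R : realType) (H : hilbert R) (n : nat) := TensorPower {
  tspace :> hilbert R ;
  tens : ('I_n -> H) -> tspace ;
  tens_multilinear : forall (u : 'I_n -> H) (i : 'I_n) (a : R[i]) (x y : H),
    tens (upd u i (a *: x + y)) = a *: tens (upd u i x) + tens (upd u i y) ;
  tens_braket : forall u v : 'I_n -> H,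
    braket (tens u) (tens v) = \prod_(i < n) braket (u i) (v i) ;
  tens_total : dense_span tens }.

Section model.
Context {R : realType} {H : hilbert R} {n : nat}.
Variables (e : nat -> H) (K : tensor_power H n).

Definition tensor_basis (i : {ffun 'I_n -> nat}) : K :=
  tens K (fun k => e (i k)).

Definition tensor_op (A : H -> H) : K -> K :=
  xget (fun _ => 0) [set B | bounded_op B /\
    forall u, B (tens K u) = tens K (fun k => A (u k))].

Record estimator := Estimator {
  est_display : measure_display ;
  outcome : measurableType est_display ;
  measurement : set outcome -> K -> K ;
  measurement_povm : povm measurement ;
  estimate : outcome -> H -> H ;
  estimate_pure : forall t, pure_states (estimate t) ;
  estimate_measurable : forall B, borel_pure e B ->
    measurable (estimate @^-1` B) }.

Arguments measurement : clear implicits.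
Arguments estimate : clear implicits.

Definition outcome_law (M : estimator) (rho : H -> H) :
    set (outcome M) -> \bar R :=
  fun E => (complex.Re
    (trace tensor_basis (tensor_op rho \o measurement M E)))%:E.

Arguments outcome_law : clear implicits.

Definition risk (dist : (H -> H) -> (H -> H) -> R) (M : estimator)
    (rho : H -> H) : \bar R :=
  (\int[outcome_law M rho]_t ((dist (estimate M t) rho) ^+ 2)%:E)%E.

Definition minimax_risk (dist : (H -> H) -> (H -> H) -> R) (alpha L : R) :
    \bar R :=
  ereal_inf [set r | exists M : estimator,
    r = ereal_sup [set ((n%:R `^ (2 * alpha / (2 * alpha + 1)))%:E
                        * risk dist M rho)%E | rho in sobolev e alpha L]].

End model.

Arguments measurement {R H n e K} _ _ _.
Arguments estimate {R H n e K} _ _ _.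
Arguments outcome_law {R H n e K} _ _ _.

(* Main.v *)
(* Assouad's method on the states [a e_0 + delta sum_(1 <= j <= N) s_j e_j] with
   signs [s_j], [delta ^ 2 = b / n] and [N] of order [n ^ (1 / (2 alpha + 1))],
   which lie in the Sobolev class for small [b].  Flipping one sign changes the
   overlap of the [n]-copy states by a bounded factor only, so no measurement
   decides a sign reliably.  Both squared losses dominate
   [||(rho^ - rho) e_0|| ^ 2], hence by Bessel the sum of the squared errors on
   the entries [<e_j|rho e_0> = a delta s_j]; each wrongly predicted sign costs
   at least [a ^ 2 delta ^ 2], and about [N] of them are expected to be wrong. *)

(* A pure state has no global phase, so a sign is meaningful only relative to another coefficient.
   The vector [e 0] is that reference: it carries at least 3/4 of the mass, its Sobolev weight is 0,
   and the entries of [rho] in its column reveal the signs. Comparing columns of operators also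
   avoids choosing a phase for the estimate. The operators behind the losses and the outcome law are
   selected by [xget], and [trace] is a limit, so each has to be computed before it can be bounded.
   For rank-one projectors this comes down to algebra in a plane, together with uniqueness of the
   selected operator and convergence of the trace. Every estimate holds for each [n >= 1], so the
   constant is explicit and the lower limit costs nothing. *)
From HB Require Import structures.
From mathcomp Require Import all_boot all_order all_algebra.
From mathcomp Require Import sesquilinear complex.
From mathcomp Require Import finmap.
From mathcomp Require Import all_classical all_reals all_analysis.
From mathcomp Require Import measurable_realfun.
From mathcomp Require Import ring lra.
From mathcomp Require summability.
Require Import Defs.
Import Order.TTheory GRing.Theory Num.Theory numFieldNormedType.Exports.
Import ComplexField.Normc.

Set Implicit Arguments.
Unset Strict Implicit.
Unset Printing Implicit Defensive.

(** * Complex numbers and inner products *)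

Section HilbertSpace.
Local Open Scope classical_set_scope.
Local Open Scope complex_scope.
Local Open Scope ring_scope.

Variables (R : realType).

Lemma normc_sqr (z : R[i]) :
  normc z ^+ 2 = complex.Re z ^+ 2 + complex.Im z ^+ 2.
Proof. by case: z => a b /=; rewrite sqr_sqrtr // addr_ge0 ?sqr_ge0. Qed.

Lemma normc_ge0 (z : R[i]) : 0 <= normc z.
Proof. by case: z => a b; exact: sqrtr_ge0. Qed.

Lemma normcE (z : R[i]) : `|z| = (normc z)%:C.
Proof. by []. Qed.

Lemma normc_realC (x : R) : normc x%:C = `|x|.
Proof. by rewrite /= expr0n /= addr0 sqrtr_sqr. Qed.

Lemma normc_ge_ReIm (z : R[i]) :
  (`|complex.Re z| <= normc z) * (`|complex.Im z| <= normc z).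
Proof.
by split; rewrite -(ger0_norm (normc_ge0 z)) -ler_sqr ?nnegrE // !real_normK
  ?num_real // normc_sqr ?lerDl ?lerDr sqr_ge0.
Qed.

Lemma ReD (x y : R[i]) : complex.Re (x + y) = complex.Re x + complex.Re y.
Proof. by case: x; case: y. Qed.
Lemma ImD (x y : R[i]) : complex.Im (x + y) = complex.Im x + complex.Im y.
Proof. by case: x; case: y. Qed.
Lemma ReN (x : R[i]) : complex.Re (- x) = - complex.Re x.
Proof. by case: x. Qed.
Lemma ReM (x y : R[i]) : complex.Re (x * y) =
  complex.Re x * complex.Re y - complex.Im x * complex.Im y.
Proof. by case: x; case: y. Qed.
Lemma ImM (x y : R[i]) : complex.Im (x * y) =
  complex.Re x * complex.Im y + complex.Im x * complex.Re y.
Proof. by case: x => a b; case: y => c d /=; ring. Qed.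
Lemma ReJ (x : R[i]) : complex.Re x^* = complex.Re x.
Proof. by case: x. Qed.
Lemma ImJ (x : R[i]) : complex.Im x^* = - complex.Im x.
Proof. by case: x. Qed.
Lemma eqC (x y : R[i]) :
  complex.Re x = complex.Re y -> complex.Im x = complex.Im y -> x = y.
Proof. by case: x => a b; case: y => c d /= -> ->. Qed.
Lemma conjcRC (x : R) : (x%:C)^* = x%:C :> R[i].
Proof. by apply: eqC => //=; rewrite oppr0. Qed.

Lemma Re_sum I (r : seq I) (P : pred I) (F : I -> R[i]) :
  complex.Re (\sum_(i <- r | P i) F i) = \sum_(i <- r | P i) complex.Re (F i).
Proof. exact: (big_morph _ ReD). Qed.

Lemma ger0_complex (z : R[i]) : 0 <= z -> z = (complex.Re z)%:C.
Proof. by move=> z0; rewrite RRe_real // ger0_real. Qed.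

Lemma ger0_Re (z : R[i]) : 0 <= z -> 0 <= complex.Re z.
Proof. by move=> z0; rewrite -ler0c -ger0_complex. Qed.

Lemma conj_mul_normc (z : R[i]) : z^* * z = (normc z ^+ 2)%:C.
Proof.
by rewrite normc_sqr; apply: eqC; rewrite ?ReM ?ImM ?ReJ ?ImJ /=; ring.
Qed.

Variable (H : preHilbert R).
Implicit Types (u v w x y : H) (a b : R[i]) (A B : H -> H).

Lemma braketDr u v w : braket u (v + w) = braket u v + braket u w.
Proof. exact: linearDl. Qed.
Lemma braketZr u a v : braket u (a *: v) = a * braket u v.
Proof. exact: linearZl_LR. Qed.
Lemma braketC u v : braket u v = (braket v u)^*.
Proof. by rewrite /braket hermC /= expr0 mul1r. Qed.
Lemma braketDl u v w : braket (v + w) u = braket v u + braket w u.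
Proof. by rewrite !(braketC _ u) braketDr rmorphD. Qed.
Lemma braketZl u a v : braket (a *: v) u = a^* * braket v u.
Proof. by rewrite !(braketC _ u) braketZr rmorphM. Qed.
Lemma braket0r u : braket u 0 = 0.
Proof. by rewrite -(scale0r (0 : H)) braketZr mul0r. Qed.
Lemma braket0l u : braket 0 u = 0.
Proof. by rewrite braketC braket0r rmorph0. Qed.
Lemma braketNr u v : braket u (- v) = - braket u v.
Proof. by rewrite -scaleN1r braketZr mulN1r. Qed.
Lemma braketNl u v : braket (- v) u = - braket v u.
Proof. by rewrite !(braketC _ u) braketNr rmorphN. Qed.
Lemma braketBr u v w : braket u (v - w) = braket u v - braket u w.
Proof. by rewrite braketDr braketNr. Qed.
Lemma braketBl u v w : braket (v - w) u = braket v u - braket w u.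
Proof. by rewrite braketDl braketNl. Qed.
Lemma braket_sumr I (r : seq I) (P : pred I) u (F : I -> H) :
  braket u (\sum_(i <- r | P i) F i) = \sum_(i <- r | P i) braket u (F i).
Proof. exact: (big_morph _ (braketDr u) (braket0r u)). Qed.
Lemma braket_suml I (r : seq I) (P : pred I) u (F : I -> H) :
  braket (\sum_(i <- r | P i) F i) u = \sum_(i <- r | P i) braket (F i) u.
Proof. exact: (big_morph (fun x => braket x u) (braketDl u) (braket0l u)). Qed.

Lemma braket_ge0 u : 0 <= braket u u.
Proof.
have [->|u0] := eqVneq u 0; first by rewrite braket0r.
by apply: ltW; exact: (@neq0_dnorm_gt0 _ _ _ (@hdot R H)) u0.
Qed.

Lemma hnorm_ge0 u : 0 <= hnorm u.
Proof. exact: sqrtr_ge0. Qed.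

Lemma braket_hnorm u : braket u u = (hnorm u ^+ 2)%:C.
Proof.
by rewrite sqr_sqrtr ?ger0_Re ?braket_ge0 // -ger0_complex // braket_ge0.
Qed.

Lemma hnorm_eq0 u : hnorm u = 0 -> u = 0.
Proof.
move=> u0; have [//|un] := eqVneq u 0.
have := @neq0_dnorm_gt0 _ _ _ (@hdot R H) _ un.
by rewrite -[hdot _ _ _]/(braket u u) braket_hnorm u0 expr0n ltxx.
Qed.

Lemma braket_inj u v : (forall w, braket w u = braket w v) -> u = v.
Proof.
move=> uv; apply/eqP; rewrite -subr_eq0; apply/eqP/hnorm_eq0.
by rewrite /hnorm braketBr uv subrr sqrtr0.
Qed.

Section linear_maps.
Variables (K : preHilbert R) (A : H -> K).
Hypothesis lA : linear A.

Lemma lin0 : A 0 = 0.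
Proof. by have := lA (-1) 0 0; rewrite scaler0 addr0 scaleN1r addNr. Qed.
Lemma linD u v : A (u + v) = A u + A v.
Proof. by rewrite -[u]scale1r lA !scale1r. Qed.
Lemma linZ a u : A (a *: u) = a *: A u.
Proof. by rewrite -[X in A X]addr0 lA lin0 addr0. Qed.
Lemma linN u : A (- u) = - A u.
Proof. by rewrite -scaleN1r linZ scaleN1r. Qed.
Lemma linB u v : A (u - v) = A u - A v.
Proof. by rewrite linD linN. Qed.
Lemma lin_sum I (r : seq I) (P : pred I) (F : I -> H) :
  A (\sum_(i <- r | P i) F i) = \sum_(i <- r | P i) A (F i).
Proof. exact: (big_morph _ linD lin0). Qed.
End linear_maps.

Section positive_maps.
Variable A : H -> H.
Hypotheses (lA : linear A) (pA : positive_op A).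

(* Polarization. *)
Lemma positive_op_selfadjoint u v : braket u (A v) = braket (A u) v.
Proof.
rewrite [RHS]braketC.
have h1 := ger0_Im (pA (u + v)); have h2 := ger0_Im (pA (u + 'i *: v)).
have hu := ger0_Im (pA u); have hv := ger0_Im (pA v).
move: h1 h2; rewrite !(linD lA) !(linZ lA) !braketDl !braketDr !braketZl.
rewrite !braketZr !(ImD, ImM, ReM, ReJ, ImJ) /= hu hv => h1 h2.
by apply: eqC; rewrite ?ReJ ?ImJ; nra.
Qed.

Lemma positive_op_CS u v :
  normc (braket u (A v)) ^+ 2 <=
  complex.Re (braket u (A u)) * complex.Re (braket v (A v)).
Proof.
set z := braket u (A v); set p := complex.Re _; set q := complex.Re _.
(* Positivity at [u - s z^* v]: the factor [z^*] makes the cross terms real, leaving a real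
   quadratic in [s]. *)
have E (s : R) : 0 <= p - 2 * s * normc z ^+ 2 + s ^+ 2 * normc z ^+ 2 * q.
  have := ger0_Re (pA (u + (- (s%:C * z^*)) *: v)).
  rewrite !(linD lA) !(linZ lA) !braketDl !braketDr !braketZl !braketZr.
  have -> : braket v (A u) = z^* by rewrite positive_op_selfadjoint -braketC.
  rewrite -/z (ger0_complex (pA v)) (ger0_complex (pA u)) -/p -/q normc_sqr.
  rewrite !(rmorphN, rmorphM, conjcRC, conjCK).
  move: z => [x y] /=; rewrite /= !(mulr0, mul0r, oppr0, addr0, subr0, opprK).
  by move=> h; lra.
have p0 : 0 <= p := ger0_Re (pA u).
have q0 : 0 <= q := ger0_Re (pA v).
set N := _ ^+ 2 in E *; have N0 : 0 <= N by rewrite sqr_ge0.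
have [q00|qn] := eqVneq q 0.
  rewrite q00 mulr0; have [N00|Nn] := eqVneq N 0; first by rewrite N00.
  (* For [q = 0] the quadratic is affine in [s], and this [s] makes it equal to [- p - 2 < 0].
     Otherwise the minimizer [1 / q] is used below. *)
  have := E ((p + 1) / N); rewrite q00 mulr0 addr0.
  by rewrite -mulrA divfK // => h; exfalso; lra.
have := E q^-1; have q1 : 0 < q by rewrite lt_neqAle eq_sym qn.
rewrite -(pmulr_rge0 _ q1) -subr_ge0; by congr (0 <= _); field; exact: qn.
Qed.
End positive_maps.

Lemma linear_id : linear (@id H).
Proof. by []. Qed.

Lemma braket_CS u v : normc (braket u v) <= hnorm u * hnorm v.
Proof.
rewrite -ler_sqr ?nnegrE ?normc_ge0 ?mulr_ge0 ?hnorm_ge0 //.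
apply: le_trans (positive_op_CS linear_id braket_ge0 u v) _.
by rewrite !braket_hnorm /= exprMn.
Qed.

Lemma hnormZ a u : hnorm (a *: u) = normc a * hnorm u.
Proof.
apply/eqP; rewrite -(eqrXn2 (n:=2)) ?mulr_ge0 ?normc_ge0 ?hnorm_ge0 //.
apply/eqP; have := braket_hnorm (a *: u); rewrite braketZl braketZr mulrA.
rewrite conj_mul_normc braket_hnorm -rmorphM /= => /complexI <-.
by rewrite exprMn.
Qed.

Lemma hnormN u : hnorm (- u) = hnorm u.
Proof. by rewrite /hnorm braketNl braketNr opprK. Qed.

Lemma hnorm0 : hnorm (0 : H) = 0.
Proof. by rewrite /hnorm braket0r sqrtr0. Qed.

Lemma hnorm_sqrD u v : hnorm (u + v) ^+ 2 =
  hnorm u ^+ 2 + 2 * complex.Re (braket u v) + hnorm v ^+ 2.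
Proof.
apply: complexI; rewrite -braket_hnorm braketDl !braketDr !braket_hnorm.
rewrite (braketC v u); apply: eqC; rewrite /= !(ReD, ImD, ReJ, ImJ) /=; ring.
Qed.

Lemma hnorm_triangle u v : hnorm (u + v) <= hnorm u + hnorm v.
Proof.
rewrite -ler_sqr ?nnegrE ?addr_ge0 ?hnorm_ge0 // hnorm_sqrD sqrrD.
rewrite lerD2r lerD2l mulr_natl ler_pMn2r //.
apply: le_trans (ler_norm _) _; apply: le_trans (normc_ge_ReIm _).1 _.
exact: braket_CS.
Qed.

End HilbertSpace.

(** * Orthonormal families and traces *)

Section Bases.
Local Open Scope classical_set_scope.
Local Open Scope complex_scope.
Local Open Scope ring_scope.

Variables (R : realType) (H : preHilbert R).
Implicit Types (u v w x y : H) (a c : R[i]).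

Section families.
Variables (I : choiceType) (b : I -> H).

Definition proj (s : seq I) u : H := \sum_(i <- s) braket (b i) u *: b i.

Hypothesis ob : forall i j, braket (b i) (b j) = (i == j)%:R.

Lemma proj_orth (s : seq I) u i : uniq s -> i \in s ->
  braket (b i) (u - proj s u) = 0.
Proof.
move=> us si; rewrite braketBr braket_sumr (bigD1_seq i) //= braketZr ob eqxx.
rewrite mulr1 big1 ?addr0 ?subrr // => j ji.
by rewrite braketZr ob eq_sym (negbTE ji) mulr0.
Qed.

Lemma hnorm_projE (s : seq I) u : uniq s ->
  hnorm (proj s u) ^+ 2 = \sum_(i <- s) normc (braket (b i) u) ^+ 2.
Proof.
move=> us; apply: complexI; rewrite -braket_hnorm {1}/proj braket_suml.
rewrite rmorph_sum /= !big_seq; apply: eq_bigr => i si.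
have /eqP := proj_orth u us si; rewrite braketBr subr_eq0 => /eqP h.
by rewrite braketZl -h conj_mul_normc.
Qed.

Lemma bessel (s : seq I) u : uniq s ->
  \sum_(i <- s) normc (braket (b i) u) ^+ 2 <= hnorm u ^+ 2.
Proof.
move=> us; rewrite -hnorm_projE // -{2}[u](subrK (proj s u)) hnorm_sqrD.
rewrite {4}/proj braket_sumr big_seq big1 ?mulr0 ?addr0 => [|i si].
  by rewrite lerDr sqr_ge0.
by rewrite braketZr (braketC (_ - _)) proj_orth // rmorph0 mulr0.
Qed.

(** Pythagoras: [u - proj s u] is orthogonal to the span of [s], which contains the competitor.
    Allowing [s] larger than [t] makes one good approximant control all larger finite sets, as
    convergence along finite sets requires. *)
Lemma proj_best (s t : seq I) u (d : I -> R[i]) : uniq s -> {subset t <= s} ->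
  hnorm (u - proj s u) <= hnorm (u - \sum_(i <- t) d i *: b i).
Proof.
move=> us ts; rewrite -ler_sqr ?nnegrE ?hnorm_ge0 //.
set w := \sum_(i <- t) _; have -> : u - w = (u - proj s u) + (proj s u - w).
  by rewrite addrA subrK.
rewrite [leRHS]hnorm_sqrD braketBr.
have o (r : seq I) (f : I -> R[i]) : {subset r <= s} ->
    braket (u - proj s u) (\sum_(i <- r) f i *: b i) = 0.
  move=> rs; rewrite braket_sumr big_seq big1 // => i ri.
  by rewrite braketZr (braketC (_ - _)) proj_orth ?rs // rmorph0 mulr0.
by rewrite !o // subrr mulr0 addr0 lerDl sqr_ge0.
Qed.

#[local] Existing Instance summability.totally_filter.

Lemma partial_sumE (T : zmodType) (f : I -> T) (A : {fset I}) :
  summability.partial_sum f A = \sum_(i <- A) f i.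
Proof. by rewrite big_seq_fsetE. Qed.

(** Convergence is part of the notion because [trace] is a bare limit; linearity is then proved on
    convergent sums. *)
Definition has_trace (A : H -> H) (l : R[i]) : Prop :=
  summability.partial_sum (fun i => braket (b i) (A (b i)) : R[i]^o)
    @ summability.totally --> (l : R[i]^o).

Lemma traceE A l : has_trace A l -> trace b A = l.
Proof.
move=> h; rewrite /trace /summability.sum.
exact: (cvg_lim (@norm_hausdorff _ _) h).
Qed.

Lemma has_traceD A B l m : has_trace A l -> has_trace B m ->
  has_trace (fun u => A u + B u) (l + m).
Proof.
move=> hA hB; have := cvgD hA hB; rewrite /has_trace.
suff -> : summability.partial_sum (fun i => braket (b i) (A (b i)) : R[i]^o)
    + summability.partial_sum (fun i => braket (b i) (B (b i)) : R[i]^o) =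
  summability.partial_sum
    (fun i => braket (b i) (A (b i) + B (b i)) : R[i]^o)
  by move=> h; exact: h.
apply/funext => S; rewrite [LHS]/GRing.add /=.
rewrite !partial_sumE -big_split /=; apply: eq_bigr => i _.
by rewrite braketDr.
Qed.

Lemma has_traceZ A l c : has_trace A l -> has_trace (fun u => c *: A u) (c * l).
Proof.
move=> hA; have := cvgZl_tmp (k := c) hA; rewrite /has_trace.
suff -> : c \*: summability.partial_sum
    (fun i => braket (b i) (A (b i)) : R[i]^o) =
  summability.partial_sum (fun i => braket (b i) (c *: A (b i)) : R[i]^o)
  by move=> h; exact: h.
apply/funext => S /=; rewrite !partial_sumE scaler_sumr; apply: eq_bigr => i _.
by rewrite braketZr.
Qed.

Hypothesis db : dense_span b.

(* Parseval's identity. *)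
Lemma has_trace_rank1 v w : has_trace (fun u => braket v u *: w) (braket v w).
Proof.
apply/cvgrPdist_lt => eps eps0.
have e0 : 0 < complex.Re eps.
  by rewrite -(ltcR 0) -ger0_complex // ltW.
have d0 : 0 < complex.Re eps / (hnorm v + 1).
  by rewrite divr_gt0 // ltr_wpDl ?hnorm_ge0.
have [t [d td]] := db w d0.
exists [fset i in t]%fset => //= S tS.
rewrite partial_sumE.
under eq_bigr do rewrite braketZr mulrC -braketZr.
have -> : \sum_(i <- S) braket v (braket (b i) w *: b i) = braket v (proj S w).
  by rewrite braket_sumr.
rewrite -[X in X < _]/(`|braket v w - braket v (proj S w)|) -braketBr normcE.
rewrite (ger0_complex (ltW eps0)) ltcR; apply: le_lt_trans (braket_CS _ _) _.
have st : {subset t <= S} by move=> i it; apply: (fsubsetP tS); rewrite inE.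
have := proj_best w d (fset_uniq S) st => /le_lt_trans/(_ td).
rewrite ltr_pdivlMr ?ltr_wpDl ?hnorm_ge0 // mulrC; apply: le_lt_trans.
by rewrite ler_wpM2r ?hnorm_ge0 // lerDl.
Qed.

End families.
End Bases.

(** * Distances between pure states *)

Section PureStates.
Local Open Scope classical_set_scope.
Local Open Scope complex_scope.
Local Open Scope ring_scope.

Variables (R : realType) (H : preHilbert R).
Implicit Types (u v w phi psi : H) (a c : R[i]) (A B Q : H -> H).

Lemma adjointE A B : (forall u v, braket (A u) v = braket u (B v)) ->
  adjoint A = B.
Proof.
move=> AB; apply: xget_unique => //= C AC; apply/funext => v.
by apply: braket_inj => u; rewrite -AC AB.
Qed.

(** Boundedness is left out: it follows by Cauchy-Schwarz in [projection_le]. *)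
Definition projection Q : Prop :=
  [/\ linear Q, forall u v, braket u (Q v) = braket (Q u) v
    & forall u, Q (Q u) = Q u].

Lemma projection_sqr Q u : projection Q -> braket u (Q u) = braket (Q u) (Q u).
Proof. by move=> [_ sQ qq]; rewrite -sQ qq. Qed.

Lemma projection_le Q u : projection Q -> hnorm (Q u) <= hnorm u.
Proof.
move=> pQ; have [->|n0] := eqVneq (hnorm (Q u)) 0; first exact: hnorm_ge0.
have n1 : 0 < hnorm (Q u) by rewrite lt_neqAle eq_sym n0 hnorm_ge0.
rewrite -(ler_pM2r n1) -expr2; apply: le_trans (braket_CS u (Q u)).
by rewrite projection_sqr // braket_hnorm normc_realC ler_norm.
Qed.

(* If [B] is another positive square root then [(B + s) (B - s) Q = 0] and
   [B + s] is injective, while [B] vanishes on the kernel of [Q]. *)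
Lemma sqrt_op_projection Q (s : R) : projection Q -> 0 <= s ->
  sqrt_op (fun u => (s ^+ 2)%:C *: Q u) = (fun u => s%:C *: Q u).
Proof.
move=> pQ s0; have [lQ sQ qq] := pQ; apply: xget_unique => /=.
  split.
  - split.
      by move=> a u v; rewrite lQ scalerDr !scalerA mulrC.
    exists s => u; rewrite hnormZ normc_realC ger0_norm //.
    by rewrite ler_wpM2l ?projection_le.
  - move=> u; rewrite braketZr projection_sqr // mulr_ge0 ?braket_ge0 //.
    by rewrite ler0c.
  - by apply/funext => u /=; rewrite (linZ lQ) qq scalerA -rmorphM -expr2.
move=> B [[lB _] pB BB].
have BBE u : B (B u) = (s ^+ 2)%:C *: Q u
  by exact: (congr1 (@^~ u) BB).
have sB := positive_op_selfadjoint lB pB.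
have Bk u : Q u = 0 -> B u = 0.
  move=> Qu; apply: hnorm_eq0; rewrite /hnorm -sB BBE Qu scaler0 braket0r.
  by rewrite sqrtr0.
have Bq u : B (Q u) = s%:C *: Q u.
  apply/eqP; rewrite -subr_eq0; apply/eqP; set v := _ - _.
  have Bv : B v = - (s%:C *: v).
    rewrite /v (linB lB) (linZ lB) BBE qq scalerBr scalerA -rmorphM -expr2.
    by rewrite opprB.
  (* Injectivity of [B + s] comes from [<v|B v> = - s |v|^2 >= 0], which is void at [s = 0]; there
     [|B w|^2 = <w|B (B w)> = 0] is used instead. *)
  have [s00|sn] := eqVneq s 0.
    rewrite /v s00 scale0r subr0; apply: hnorm_eq0.
    by rewrite /hnorm -sB BBE s00 expr0n scale0r braket0r sqrtr0.
  have := ger0_Re (pB v); rewrite Bv braketNr braketZr braket_hnorm.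
  rewrite ReN ReM /= mulr0 subr0 oppr_ge0 pmulr_rle0; last first.
    by rewrite lt_neqAle eq_sym sn s0.
  move=> h; apply: hnorm_eq0; apply/eqP; rewrite -sqrf_eq0.
  by rewrite eq_le h sqr_ge0.
apply/funext => u; rewrite -[u in LHS](subrK (Q u)) (linD lB) Bq Bk ?add0r //.
by rewrite (linB lQ) qq subrr.
Qed.

Lemma linear_ketbra psi : linear (ketbra psi).
Proof.
by move=> a u v; rewrite /ketbra braketDr braketZr scalerDl scalerA.
Qed.

Lemma projection_ketbra psi : hnorm psi = 1 -> projection (ketbra psi).
Proof.
move=> n1; split; [exact: linear_ketbra| |] => u; rewrite /ketbra.
  by move=> v; rewrite braketZr braketZl -braketC mulrC.
by rewrite braketZr braket_hnorm n1 expr1n mulr1.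
Qed.

Lemma ketbra_scale1 psi : ketbra psi = fun u => (1 ^+ 2)%:C *: ketbra psi u.
Proof. by apply/funext => u; rewrite expr1n scale1r. Qed.

Section two_states.
Variables phi psi : H.
Hypotheses (n1 : hnorm phi = 1) (n2 : hnorm psi = 1).
Let c := braket phi psi.
Let s := Num.sqrt (1 - normc c ^+ 2).

Let c1 : normc c <= 1.
Proof. by have := braket_CS phi psi; rewrite n1 n2 mulr1. Qed.

Let s2 : s ^+ 2 = 1 - normc c ^+ 2.
Proof. by rewrite sqr_sqrtr // subr_ge0 expr_le1 ?normc_ge0. Qed.

Let b11 : braket phi phi = 1.
Proof. by rewrite braket_hnorm n1 expr1n. Qed.
Let b22 : braket psi psi = 1.
Proof. by rewrite braket_hnorm n2 expr1n. Qed.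
Let b21 : braket psi phi = c^*.
Proof. by rewrite braketC. Qed.

Let D u := ketbra phi u - ketbra psi u.

(* [D] acts on the plane of [phi] and [psi] with eigenvalues [s] and [-s]. *)
Lemma ketbra_diff_sqr : exists Q, [/\ projection Q,
   forall u, D (D u) = (s ^+ 2)%:C *: Q u
 & forall (I : choiceType) (b : I -> H),
     (forall i j, braket (b i) (b j) = (i == j)%:R) -> dense_span b ->
     has_trace b (fun u => s%:C *: Q u) (2 * s)%:C].
Proof.
have cc : c^* * c = (1 - s ^+ 2)%:C.
  by rewrite conj_mul_normc s2 opprB addrC subrK.
have [s0|sn] := eqVneq s 0.
  (* The states differ by a phase and [D = 0], so any projection of finite trace would serve. *)
  exists (ketbra phi); split; first exact: projection_ketbra.
    have pc : psi = c *: phi.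
      apply/eqP; rewrite -subr_eq0; apply/eqP/hnorm_eq0.
      rewrite /hnorm braketBl !braketBr !braketZl !braketZr b11 b22 b21 -/c.
      by rewrite mulr1 subrr subr0 mulrC cc s0 expr0n subr0 subrr sqrtr0.
    have D0 u : D u = 0.
      rewrite /D /ketbra pc braketZl scalerA mulrAC.
      by rewrite cc s0 expr0n subr0 mul1r subrr.
    by move=> u; rewrite D0 s0 expr0n scale0r.
  move=> I b ob db; rewrite s0 mulr0 -[X in has_trace _ _ X](mul0r (1 : R[i])).
  by apply: has_traceZ => //; rewrite -b11; exact: has_trace_rank1.
(* Gram-Schmidt; [Q] will be the projection onto the plane, of trace 2. *)
pose phi' := s^-1%:C *: (psi - c *: phi).
have pE : psi = c *: phi + s%:C *: phi'.
  by rewrite /phi' scalerA -rmorphM divff // scale1r addrC subrK.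
have b1' : braket phi phi' = 0.
  by rewrite braketZr braketBr braketZr b11 mulr1 subrr mulr0.
have b'1 : braket phi' phi = 0 by rewrite braketC b1' rmorph0.
have b'' : braket phi' phi' = 1.
  rewrite braketZr braketZl braketBl !braketBr !braketZl !braketZr b11 b22 b21.
  rewrite -/c mulr1 subrr subr0 mulrC (mulrC c) cc conjcRC -rmorphB opprB.
  by rewrite addrC subrK -!rmorphM; congr (_%:C); field; exact: sn.
clearbody phi'.
pose Q u := ketbra phi u + ketbra phi' u.
have n' : hnorm phi' = 1 by rewrite /hnorm b'' sqrtr1.
have [l1 a1 p1] := projection_ketbra n1.
have [l' a' p'] := projection_ketbra n'.
exists Q; split.
- split.
  + by move=> a u v; rewrite /Q l1 l' scalerDr addrACA.
  + by move=> u v; rewrite /Q braketDr braketDl a1 a'.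
  + move=> u; rewrite /Q !(linD l1, linD l') p1 p' /ketbra !braketZr b1' b'1.
    by rewrite !mulr0 !scale0r addr0 add0r.
- move=> u; rewrite /D /Q /ketbra pE !braketDl !braketZl conjcRC.
  set x := braket phi u; set y := braket phi' u.
  rewrite !(braketBr, braketDr, braketZr) b11 b1' b'1 b'' -/x -/y.
  have cf p q : p *: phi - q *: (c *: phi + s%:C *: phi') =
      (p - q * c) *: phi + (- (q * s%:C)) *: phi'.
    by rewrite scalerDr !scalerA opprD addrA -!scaleNr -scalerDl.
  rewrite !cf scalerDr !scalerA.
  have sE : (s ^+ 2)%:C = s%:C * s%:C by rewrite expr2 rmorphM.
  move: cc; rewrite rmorphB rmorph1 /= sE.
  move: (c^*) (s%:C) => d S cc.
  have {}cc : d * c + S * S - 1 = 0 by rewrite cc; ring.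
  (* The coefficients agree only modulo [|c|^2 + s^2 = 1]; [e0] adds an explicit multiple of this
     relation so that [ring] can conclude. *)
  have e0 (t k : R[i]) : t = t + k * (d * c + S * S - 1).
    by rewrite cc mulr0 addr0.
  congr (_ *: _ + _ *: _).
    by rewrite [RHS](e0 _ ((d * x + S * y) * c - x)); ring.
  by rewrite [RHS](e0 _ (S * (d * x + S * y))); ring.
- move=> I b ob db; rewrite (_ : (2 * s)%:C = s%:C * (1 + 1)); last first.
    by rewrite mulrDr mulr1 -rmorphD mulr_natl.
  rewrite -{1}b11 -b''; apply: has_traceZ; apply: has_traceD => //.
  + exact: has_trace_rank1.
  + exact: has_trace_rank1.
Qed.

Let sD u v : braket u (D v) = braket (D u) v.
Proof.
have [_ s1 _] := projection_ketbra n1; have [_ s' _] := projection_ketbra n2.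
by rewrite /D braketBr braketBl s1 s'.
Qed.

(** [D] is self-adjoint with [D^2 = s^2 Q], so [|D u|^2 = <u|D^2 u> = s^2 |Q u|^2], and [Q] is a
    contraction. *)
Lemma hnorm_ketbra_diff u : hnorm (ketbra phi u - ketbra psi u) ^+ 2 <=
  (1 - normc (braket phi psi) ^+ 2) * hnorm u ^+ 2.
Proof.
have [Q [pQ DD _]] := ketbra_diff_sqr.
have h : hnorm (D u) ^+ 2 = s ^+ 2 * hnorm (Q u) ^+ 2.
  apply: complexI; rewrite -braket_hnorm -sD DD braketZr projection_sqr //.
  by rewrite braket_hnorm -rmorphM.
rewrite -/(D u) -/c -s2 h ler_wpM2l ?sqr_ge0 //.
by rewrite ler_sqr ?nnegrE ?hnorm_ge0 // projection_le.
Qed.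

Section distances.
Variables (I : choiceType) (b : I -> H).
Hypotheses (ob : forall i j, braket (b i) (b j) = (i == j)%:R).
Hypothesis db : dense_span b.

Lemma trace_dist_ketbra : trace_dist b (ketbra phi) (ketbra psi) = 2 * s.
Proof.
have [Q [pQ DD tQ]] := ketbra_diff_sqr.
rewrite /trace_dist /abs_op (adjointE (B := D)) //.
rewrite (_ : D \o _ = fun u => (s ^+ 2)%:C *: Q u); last first.
  by apply/funext => u; exact: DD.
by rewrite sqrt_op_projection ?sqrtr_ge0 // (traceE (tQ _ _ ob db)).
Qed.

(** A projector is its own square root, and [rho sigma rho = |c|^2 rho] has square root [|c| rho],
    of trace [|c|]. *)
Lemma bures_dist_ketbra :
  bures_dist b (ketbra phi) (ketbra psi) ^+ 2 = 2 * (1 - normc c).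
Proof.
have p1 := projection_ketbra n1.
have q1 : sqrt_op (ketbra phi) = ketbra phi.
  rewrite [in LHS]ketbra_scale1 sqrt_op_projection //.
  by apply/funext => u; rewrite scale1r.
have q2 : ketbra phi \o ketbra psi \o ketbra phi =
    fun u => (normc c ^+ 2)%:C *: ketbra phi u.
  apply/funext => u; rewrite /ketbra /= !braketZr b21 -/c -conj_mul_normc.
  by rewrite scalerA; congr (_ *: _); rewrite mulrAC mulrC mulrA mulrAC.
rewrite /bures_dist q1 q2 sqrt_op_projection ?normc_ge0 //.
rewrite (traceE (has_traceZ (c := (normc c)%:C)
  (has_trace_rank1 (v := phi) (w := phi) ob db))).
by rewrite b11 mulr1 sqr_sqrtr // mulr_ge0 // subr_ge0.
Qed.

Lemma hnorm_ketbra_diff_le_trace_dist u : hnorm u = 1 ->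
  hnorm (ketbra phi u - ketbra psi u) ^+ 2 <=
  trace_dist b (ketbra phi) (ketbra psi) ^+ 2.
Proof.
move=> u1; apply: le_trans (hnorm_ketbra_diff u) _.
rewrite u1 trace_dist_ketbra exprMn -/c -s2 expr1n mulr1.
by rewrite ler_peMl ?sqr_ge0 // -natrX ler1n.
Qed.

(** Since [(1 - |c|)^2 >= 0], the bound [1 - |c|^2] is at most [2 (1 - |c|)]. *)
Lemma hnorm_ketbra_diff_le_bures_dist u : hnorm u = 1 ->
  hnorm (ketbra phi u - ketbra psi u) ^+ 2 <=
  bures_dist b (ketbra phi) (ketbra psi) ^+ 2.
Proof.
move=> u1; apply: le_trans (hnorm_ketbra_diff u) _.
rewrite u1 bures_dist_ketbra -/c expr1n mulr1.
by have := sqr_ge0 (1 - normc c); rewrite sqrrB; lra.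
Qed.

End distances.
End two_states.

End PureStates.

(** * Tensor powers *)

Section Tensors.
Local Open Scope classical_set_scope.
Local Open Scope complex_scope.
Local Open Scope ring_scope.

Variable R : realType.

Section closed_span.
Variables (H : preHilbert R) (I : choiceType) (b : I -> H).
Hypothesis ob : forall i j, braket (b i) (b j) = (i == j)%:R.

Definition in_closed_span (u : H) : Prop := forall eps : R, 0 < eps ->
  exists (s : seq I) (c : I -> R[i]),
    hnorm (u - \sum_(i <- s) c i *: b i) < eps.

(** Both approximants are replaced by projections onto one common index set, whose coefficients can
    be added. *)
Lemma in_closed_span_lin a u v : in_closed_span u -> in_closed_span v ->
  in_closed_span (a *: u + v).
Proof.
move=> hu hv eps eps0; have a0 := normc_ge0 a.
have d0 : 0 < eps / (normc a + 1) / 2 by rewrite !divr_gt0 // ltr_wpDl.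
have [s [c sc]] := hu _ d0; have [t [d td]] := hv _ d0.
pose r := undup (s ++ t); exists r, (fun i => braket (b i) (a *: u + v)).
have ru : uniq r by exact: undup_uniq.
have sr : {subset s <= r} by move=> i si; rewrite mem_undup mem_cat si.
have tr : {subset t <= r} by move=> i si; rewrite mem_undup mem_cat si orbT.
have -> : \sum_(i <- r) braket (b i) (a *: u + v) *: b i =
    a *: proj b r u + proj b r v.
  rewrite scaler_sumr -big_split /=; apply: eq_bigr => i _.
  by rewrite braketDr braketZr scalerDl scalerA.
have -> : a *: u + v - (a *: proj b r u + proj b r v) =
    a *: (u - proj b r u) + (v - proj b r v).
  by rewrite scalerBr opprD addrACA.
apply: le_lt_trans (hnorm_triangle _ _) _; rewrite hnormZ.
have h1 := le_lt_trans (proj_best ob u c ru sr) sc.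
have h2 := le_lt_trans (proj_best ob v d ru tr) td.
have -> : eps = normc a * (eps / (normc a + 1)) + eps / (normc a + 1).
  by field; rewrite gt_eqF // ltr_wpDl.
apply: ler_ltD.
  by rewrite ler_wpM2l //; apply: ltW; apply: lt_trans h1 _; lra.
by apply: lt_trans h2 _; lra.
Qed.

Lemma in_closed_span0 : in_closed_span 0.
Proof.
by move=> eps eps0; exists [::], (fun=> 0); rewrite big_nil subr0 hnorm0.
Qed.

Lemma in_closed_span_sum T (s : seq T) (c : T -> R[i]) (f : T -> H) :
  (forall i, in_closed_span (f i)) ->
  in_closed_span (\sum_(i <- s) c i *: f i).
Proof.
move=> hf; elim: s => [|i s ih].
  by rewrite big_nil; exact: in_closed_span0.
by rewrite big_cons; exact: in_closed_span_lin.
Qed.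

Lemma in_closed_span_lim u : (forall eps : R, 0 < eps ->
  exists2 v, in_closed_span v & hnorm (u - v) < eps) -> in_closed_span u.
Proof.
move=> h eps eps0; have e2 : 0 < eps / 2 by rewrite divr_gt0.
have [v hv uv] := h _ e2; have [s [c sc]] := hv _ e2; exists s, c.
rewrite -(subrK v u) -addrA (splitr eps).
apply: le_lt_trans (hnorm_triangle _ _) _.
exact: ltrD.
Qed.

End closed_span.

(** Serves to show that [tensor_op] has only one candidate, elementary tensors being total. *)
Lemma bounded_op_eq (H : preHilbert R) T (b : T -> H) (A B : H -> H) :
  dense_span b -> bounded_op A -> bounded_op B ->
  (forall t, A (b t) = B (b t)) -> A = B.
Proof.
move=> db [lA [C hA]] [lB [D hB]] AB; apply/funext => u.
apply/eqP; rewrite -subr_eq0; apply/eqP/hnorm_eq0; apply/eqP.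
rewrite eq_le hnorm_ge0 andbT; apply/ler_addgt0Pl => eps eps0; rewrite addr0.
have d0 : 0 < eps / (`|C| + `|D| + 1).
  by rewrite divr_gt0 // ltr_wpDl // addr_ge0.
have [s [c sc]] := db u _ d0; set w := \sum_(i <- s) _ in sc.
have -> : A u - B u = A (u - w) - B (u - w).
  rewrite (linB lA) (linB lB).
  have -> : A w = B w.
    rewrite (lin_sum lA) (lin_sum lB); apply: eq_bigr => i _.
    by rewrite (linZ lA) (linZ lB) AB.
  by rewrite opprB addrA subrK.
apply: le_trans (hnorm_triangle _ _) _; rewrite hnormN.
apply: le_trans (lerD (hA _) (hB _)) _; rewrite -mulrDl.
rewrite ltr_pdivlMr in sc; last by rewrite ltr_wpDl // addr_ge0.
apply: le_trans (ltW sc); rewrite mulrC ler_wpM2l ?hnorm_ge0 //.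
have := ler_norm C; have := ler_norm D; lra.
Qed.

Lemma bounded_ketbra (H : preHilbert R) (psi : H) : bounded_op (ketbra psi).
Proof.
split; first exact: linear_ketbra.
exists (hnorm psi ^+ 2) => u.
rewrite hnormZ expr2 mulrAC ler_wpM2r ?hnorm_ge0 //.
exact: braket_CS.
Qed.

Variables (H : hilbert R) (n : nat) (K : tensor_power H n).

Lemma hnorm_tens (u : 'I_n -> H) : hnorm (tens K u) = \prod_i hnorm (u i).
Proof.
apply/eqP; rewrite -(eqrXn2 (n:=2)) ?hnorm_ge0 ?prodr_ge0 //; last first.
  by move=> i _; exact: hnorm_ge0.
apply/eqP/complexI; rewrite -braket_hnorm tens_braket -prodrXl rmorph_prod.
by apply: eq_bigr => i _; rewrite braket_hnorm.
Qed.

Lemma linear_tens_upd (u : 'I_n -> H) i : linear (fun x => tens K (upd u i x)).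
Proof. by move=> a x y; rewrite tens_multilinear. Qed.

Lemma hnorm_tens_upd (u : 'I_n -> H) i x :
  hnorm (tens K (upd u i x)) = hnorm x * \prod_(j | j != i) hnorm (u j).
Proof.
rewrite hnorm_tens (bigD1 i) //= /upd eqxx; congr (_ * _).
by apply: eq_bigr => j ji; rewrite (negbTE ji).
Qed.

(** The squared norm of the difference expands into inner products that cancel; this replaces an
    induction over the factors. *)
Lemma tens_scale (c : 'I_n -> R[i]) (u : 'I_n -> H) :
  tens K (fun k => c k *: u k) = (\prod_k c k) *: tens K u.
Proof.
apply/eqP; rewrite -subr_eq0; apply/eqP/hnorm_eq0.
rewrite /hnorm braketBl !braketBr !braketZl !braketZr !tens_braket.
have -> : \prod_i braket (c i *: u i) (c i *: u i) =
    (\prod_i c i)^* * ((\prod_i c i) * \prod_i braket (u i) (u i)).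
  rewrite rmorph_prod -!big_split; apply: eq_bigr => i _.
  by rewrite braketZl braketZr.
have -> : \prod_i braket (c i *: u i) (u i) =
    (\prod_i c i)^* * \prod_i braket (u i) (u i).
  by rewrite rmorph_prod -!big_split; apply: eq_bigr => i _; rewrite braketZl.
have -> : \prod_i braket (u i) (c i *: u i) =
    (\prod_i c i) * \prod_i braket (u i) (u i).
  by rewrite -!big_split; apply: eq_bigr => i _; rewrite braketZr.
rewrite [X in complex.Re X](_ : _ = 0) ?sqrtr0 //; ring.
Qed.

Lemma tensor_opE (psi : H) :
  tensor_op (K := K) (ketbra psi) = ketbra (tens K (fun=> psi)).
Proof.
have h u : ketbra (tens K (fun=> psi)) (tens K u) =
    tens K (fun k => ketbra psi (u k)).
  by rewrite tens_scale /ketbra tens_braket.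
apply: xget_unique; first by split; [exact: bounded_ketbra|exact: h].
move=> B [bB hB]; apply: (bounded_op_eq (@tens_total _ _ _ K)) => //.
  exact: bounded_ketbra.
by move=> u; rewrite hB h.
Qed.

Section basis.
Variable e : nat -> H.
Hypothesis he : orthonormal_basis e.

Lemma tensor_basis_orthonormal i j :
  braket (tensor_basis e K i) (tensor_basis e K j) = (i == j)%:R.
Proof.
rewrite tens_braket; have [->|ij] := eqVneq i j.
  by rewrite big1 // => k _; rewrite he.1 eqxx.
have [k kij] : exists k, i k != j k.
  apply/existsP; apply: contraNT ij; rewrite negb_exists => /forallP ij.
  by apply/eqP/ffunP => k; apply/eqP; have := ij k; rewrite negbK.
by rewrite (bigD1 k) //= he.1 (negbTE kij) mul0r.
Qed.

(** Induction on the number of leading factors that may be arbitrary. One factor at a time is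
    approximated by a finite combination of basis vectors; the error is multiplied by the norms of
    the other factors. *)
Let in_span_tens (k : nat) (u : 'I_n -> H) :
  (forall i : 'I_n, (k <= i)%N -> exists m, u i = e m) ->
  in_closed_span (tensor_basis e K) (tens K u).
Proof.
have ob := tensor_basis_orthonormal.
elim: k u => [|k ih] u hu.
  have [m hm] := choice (fun i => hu i (leq0n i)).
  move=> eps eps0; exists [:: [ffun i => m i]], (fun=> 1).
  rewrite big_seq1 scale1r /tensor_basis.
  rewrite (_ : (fun _ => e _) = u) ?subrr ?hnorm0 //.
  by apply/funext => i; rewrite ffunE hm.
have [kn|nk] := ltnP k n; last first.
  apply: ih => i ki; exfalso; have := ltn_ord i.
  by rewrite ltnNge (leq_trans nk ki).
pose i0 := Ordinal kn.
have uE : u = upd u i0 (u i0).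
  by apply/funext => j; rewrite /upd; case: eqP => [->|].
apply: (in_closed_span_lim) => eps eps0.
set C := \prod_(j | j != i0) hnorm (u j).
have C0 : 0 <= C by apply: prodr_ge0 => j _; exact: hnorm_ge0.
have d0 : 0 < eps / (C + 1) by rewrite divr_gt0 // ltr_wpDl.
have [s [c sc]] := he.2 (u i0) _ d0.
have lf := linear_tens_upd u i0.
exists (tens K (upd u i0 (\sum_(i <- s) c i *: e i))).
  rewrite (lin_sum lf); under eq_bigr do rewrite (linZ lf).
  apply: in_closed_span_sum => // m; apply: ih => i ki.
  rewrite /upd; case: eqP => [_|/eqP ii]; first by exists m.
  by apply: hu; rewrite ltn_neqAle ki andbT eq_sym.
rewrite [in X in hnorm (X - _)]uE -(linB lf) hnorm_tens_upd -/C.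
rewrite ltr_pdivlMr in sc; last by rewrite ltr_wpDl.
by apply: le_lt_trans sc; rewrite ler_wpM2l ?hnorm_ge0 // lerDl.
Qed.

Lemma tensor_basis_dense : dense_span (tensor_basis e K).
Proof.
move=> u; apply: in_closed_span_lim => eps eps0.
have [s [c sc]] := @tens_total _ _ _ K u _ eps0.
exists (\sum_(i <- s) c i *: tens K i) => //.
apply: in_closed_span_sum => [|v]; first exact: tensor_basis_orthonormal.
(* With [k = n] no factor is constrained. *)
by apply: (@in_span_tens n) => i; rewrite leqNgt ltn_ord.
Qed.
End basis.
End Tensors.

(** * Measurements and outcome laws *)

Section Measurements.
Local Open Scope classical_set_scope.
Local Open Scope complex_scope.
Local Open Scope ring_scope.

Import HBNNSimple.

Variables (R : realType) (d : measure_display) (T : measurableType d).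

(** Simple functions evaluate [mu] on measurable sets only. This matters because [outcome_law] is a
    mere set function, of which nothing is known off the measurable sets. *)
Lemma eq_integral_measurable (mu : set T -> \bar R)
    (m : {measure set T -> \bar R}) (f : T -> \bar R) :
  (forall E, measurable E -> mu E = m E) ->
  (\int[mu]_t f t = \int[m]_t f t)%E.
Proof.
move=> mum.
have sE (h : {nnsfun T >-> R}) : sintegral mu h = sintegral m h.
  apply: eq_fsbigr => x _; congr (_ * _)%E; apply: mum.
  exact: measurable_funPTI.
rewrite /integral; congr (ereal_sup _ - ereal_sup _)%E; apply/seteqP; split;
  by move=> _ [h hf <-]; exists h.
Qed.

(** The integral is a supremum over simple functions below [f], so one such function suffices; this
    avoids proving that the loss is a measurable function of the outcome. *)
Lemma integral_ge_indic_sum (m : {measure set T -> \bar R}) (f : T -> R)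
    (A : nat -> set T) (N : nat) (c : R) :
  (forall j, measurable (A j)) -> 0 <= c ->
  (forall t, \sum_(j < N) c * \1_(A j) t <= f t) ->
  (\sum_(j < N) c%:E * m (A j) <= \int[m]_t (f t)%:E)%E.
Proof.
move=> mA c0 hf.
have f0 t : 0 <= f t.
  by apply: le_trans (hf t); apply: sumr_ge0 => j _; rewrite mulr_ge0.
pose h := sum_nnsfun (fun j => scale_nnsfun (indic_nnsfun R (mA j)) c0) N.
have -> : (\sum_(j < N) c%:E * m (A j) = sintegral m h)%E.
  have := integral_nnsfun m measurableT h; rewrite patch_setT => <-.
  have hE t : (h t)%:E = (\sum_(j < N) c%:E * (\1_(A j) t)%:E)%E.
    rewrite /h sum_nnsfunE /= -sumEFin; apply: eq_bigr => j _.
    by rewrite EFinM.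
  under eq_integral do rewrite hE.
  rewrite ge0_integral_sum //.
  - apply: eq_bigr => j _; rewrite ge0_integralZl_EFin //.
      by rewrite integral_indic // setIT.
    exact/measurable_EFinP.
  - by move=> j; apply: measurable_funeM; exact/measurable_EFinP.
  - by move=> j t _; rewrite mule_ge0 // lee_fin.
rewrite ge0_integralE => [|t _]; last by rewrite lee_fin.
rewrite patch_setT; apply: ereal_sup_ubound; exists h => //= t.
rewrite lee_fin; apply: le_trans (hf t); rewrite /h sum_nnsfunE /=.
by rewrite lexx.
Qed.

Section povm.
Variables (H : preHilbert R) (M : set T -> H -> H).
Hypothesis povmM : povm M.
Implicit Types (u v psi : H) (E : set T).

Lemma povm_linear E : measurable E -> linear (M E).
Proof. by move=> mE; have [h _ _] := povmM; have [[]] := h _ mE. Qed.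

Lemma povm_positive E : measurable E -> positive_op (M E).
Proof. by move=> mE; have [h _ _] := povmM; have [] := h _ mE. Qed.

(** For a constant sequence of empty sets the partial sums [m z] converge, while consecutive ones
    differ by [z]. *)
Lemma povm_set0 u v : braket u (M set0 v) = 0.
Proof.
have [_ h _] := povmM.
have := h (fun=> set0) (fun=> measurable0) (@trivIset_set0 _ _ _) u v.
set z := braket u _; rewrite bigcup0 // -/z => hz.
have {}hz : (fun m => normc (z *+ m - z)) @ \oo --> (0 : R).
  by under eq_fun do rewrite -[m in z *+ m]subn0 -sumr_const_nat.
apply/eqP; rewrite -normr_eq0 normcE; apply/eqP; congr (_%:C).
apply/eqP; rewrite eq_le normc_ge0 andbT; apply/ler_addgt0Pl => eps eps0.
rewrite addr0; have [N _ hN] := (cvgrPdist_lt _ _).1 hz (eps / 2)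
  (divr_gt0 eps0 (ltr0Sn _ 1)).
have h1 := hN N (leqnn N); have h2 := hN N.+1 (leqnSn N).
rewrite /= !sub0r !normrN !ger0_norm ?normc_ge0 // in h1 h2.
have -> : z = (z *+ N.+1 - z) - (z *+ N - z).
  by rewrite mulrSr addrK opprB addrCA subrr addr0.
apply: le_trans (le_normcD _ _) _; rewrite normcN (splitr eps).
by apply: lerD; exact: ltW.
Qed.

Lemma povm_setC E u v : measurable E ->
  braket u (M E v) + braket u (M (~` E) v) = braket u v.
Proof.
move=> mE; have [_ h M1] := povmM.
have mF k : measurable (bigcup2 E (~` E) k).
  by case: k => [|[|k]] //=; exact: measurableC.
have tF : trivIset setT (bigcup2 E (~` E)) by rewrite -trivIset_bigcup2 setICr.
have := h _ mF tF u v; rewrite bigcup2E setUCr M1 => /cvgrPdist_lt hz.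
apply/eqP; rewrite -subr_eq0 -normr_eq0 normcE; apply/eqP; congr (_%:C).
apply/eqP; rewrite eq_le normc_ge0 andbT; apply/ler_addgt0Pl => eps eps0.
(* [N.+2] terms are certain to include both [E] and its complement; the others are empty. *)
have [N _ hN] := hz _ eps0; have := hN N.+2 (leq_trans (leqnSn _) (leqnSn _)).
rewrite /= sub0r normrN ger0_norm ?normc_ge0 // !big_nat_recl //= addrA.
by rewrite big1 ?addr0 => [|k _]; [exact: ltW|exact: povm_set0].
Qed.

(** A measure must be nonnegative on every set, but [M] is controlled on measurable ones only;
    [Num.max 0] repairs the sign elsewhere. *)
Lemma semi_sigma_additive_born psi : semi_sigma_additive
  (fun E => (Num.max 0 (complex.Re (braket psi (M E psi))))%:E).
Proof.
have [_ h _] := povmM.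
have mx E : measurable E -> Num.max 0 (complex.Re (braket psi (M E psi))) =
    complex.Re (braket psi (M E psi)).
  by move=> mE; rewrite max_r //; apply: ger0_Re; exact: povm_positive.
move=> F mF tF mUF; rewrite mx //.
have -> : (fun n => \sum_(0 <= i < n)
      (Num.max 0 (complex.Re (braket psi (M (F i) psi))))%:E)%E =
    EFin \o (fun n => complex.Re (\sum_(0 <= i < n) braket psi (M (F i) psi))).
  apply/funext => n /=; rewrite sumEFin Re_sum; congr (_%:E).
  by apply: eq_bigr => i _; rewrite mx.
apply: cvg_EFin; first exact: nearW.
apply/cvgrPdist_lt => eps eps0.
have [N _ hN] := (cvgrPdist_lt _ _).1 (h F mF tF psi psi) eps eps0.
exists N => // n Nn; have := hN n Nn; rewrite /= sub0r normrN.
rewrite ger0_norm ?normc_ge0 //; apply: le_lt_trans.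
rewrite distrC -ReN -ReD; exact: (normc_ge_ReIm _).1.
Qed.

Lemma born_measure psi : exists m : {measure set T -> \bar R},
  forall E, measurable E -> m E = (complex.Re (braket psi (M E psi)))%:E.
Proof.
pose mu E := (Num.max 0 (complex.Re (braket psi (M E psi))))%:E.
have mu0 : mu set0 = 0%E by rewrite /mu povm_set0 maxxx.
have mu_ge0 E : (0 <= mu E)%E by rewrite lee_fin le_max lexx.
pose m := isMeasure.Build _ _ _ mu mu0 mu_ge0 (@semi_sigma_additive_born psi).
pose mm : {measure set T -> \bar R} :=
  HB.pack_for {measure set T -> \bar R} mu m.
exists mm => E mE; rewrite /= /mu max_r //.
by apply: ger0_Re; exact: povm_positive.
Qed.

End povm.

End Measurements.

(** * Lower bound on the risk *)

Section Risk.
Local Open Scope classical_set_scope.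
Local Open Scope complex_scope.
Local Open Scope ring_scope.

Variable R : realType.

(* [<phi|psi>] splits as [<phi|M E psi> + <phi|M (~` E) psi>], and each term is
   bounded by Cauchy-Schwarz for the corresponding positive form. *)
Lemma povm_testing (d : measure_display) (T : measurableType d)
    (H : preHilbert R) (M : set T -> H -> H) (E : set T) (phi psi : H) :
  povm M -> measurable E -> hnorm phi = 1 -> hnorm psi = 1 ->
  normc (braket phi psi) ^+ 2 / 2 <=
  complex.Re (braket phi (M E phi)) + complex.Re (braket psi (M (~` E) psi)).
Proof.
move=> pM mE n1 n2; have mE' := measurableC mE.
have h := povm_setC pM phi psi mE.
have h1 := congr1 (@complex.Re R) (povm_setC pM phi phi mE).
have h2 := congr1 (@complex.Re R) (povm_setC pM psi psi mE).
rewrite braket_hnorm n1 expr1n ReD /= in h1.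
rewrite braket_hnorm n2 expr1n ReD /= in h2.
have c1 := positive_op_CS (povm_linear pM mE) (povm_positive pM mE) phi psi.
have c2 := positive_op_CS (povm_linear pM mE') (povm_positive pM mE') phi psi.
have p1 := ger0_Re (povm_positive pM mE phi).
have p2 := ger0_Re (povm_positive pM mE psi).
have p3 := ger0_Re (povm_positive pM mE' phi).
have p4 := ger0_Re (povm_positive pM mE' psi).
have t := le_normcD (braket phi (M E psi)) (braket phi (M (~` E) psi)).
rewrite h in t; have t0 := normc_ge0 (braket phi psi).
move: c1 c2 p1 p2 p3 p4 h1 h2 t t0.
move: (normc _) (normc _) (normc _) => g B A.
move: (complex.Re _) (complex.Re _) (complex.Re _) (complex.Re _).
move=> q' p' q p c1 c2 p0 q0 p0' q0' h1 h2 t t0.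
have g2 : g ^+ 2 <= (A + B) ^+ 2 by rewrite ler_sqr ?nnegrE // (le_trans t0 t).
(* In each product the factor absent from the conclusion is at most 1, as [E] and its complement
   have total mass 1. Then [(A + B)^2 <= 2 (A^2 + B^2)]. *)
have cA : A ^+ 2 <= p by apply: le_trans c1 _; rewrite ler_piMr //; lra.
have cB : B ^+ 2 <= q' by apply: le_trans c2 _; rewrite ler_piMl //; lra.
by have := sqr_ge0 (A - B); move: g2; rewrite sqrrD sqrrB; lra.
Qed.

Section open_sets.
Variables (H : preHilbert R) (I : choiceType) (b : I -> H).
Hypothesis ob : forall i j, braket (b i) (b j) = (i == j)%:R.
Hypothesis db : dense_span b.

Definition Re_entry_pos (u v : H) : set (H -> H) :=
  [set sigma | pure_states sigma /\ 0 < complex.Re (braket u (sigma v))].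

(** The set is open: an entry between unit vectors is 1-Lipschitz for the trace distance, so the
    value of its real part is an admissible radius. *)
Lemma borel_Re_entry_pos u v : hnorm u = 1 -> hnorm v = 1 ->
  borel_pure b (Re_entry_pos u v).
Proof.
move=> u1 v1; apply: sub_gen_smallest; split; first by move=> ? [].
move=> _ [[phi [n1 ->]]]; exists (complex.Re (braket u (ketbra phi v))) => //.
move=> _ [psi [n2 ->]] h; split; first by exists psi.
have := hnorm_ketbra_diff_le_trace_dist n1 n2 ob db v1.
rewrite ler_sqr ?nnegrE ?hnorm_ge0 //; last first.
  by rewrite trace_dist_ketbra // mulr_ge0 // sqrtr_ge0.
move=> /le_lt_trans/(_ h) {}h.
have := le_lt_trans (braket_CS u (ketbra phi v - ketbra psi v)).
rewrite u1 mul1r => /(_ _ h) {}h.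
have := le_lt_trans (normc_ge_ReIm _).1 h; rewrite braketBr ReD ReN => {}h.
by have := le_lt_trans (ler_norm _) h; lra.
Qed.
End open_sets.

Section model.
Variables (H : hilbert R) (n : nat) (e : nat -> H).
Hypothesis he : orthonormal_basis e.
Variables (K : tensor_power H n) (M : estimator e K).

(** Sign [j] sits on [e j.+1], since [e 0] is the reference. A zero real part counts as predicting a
    minus sign. *)
Definition predicted_pos (j : nat) : set (outcome M) :=
  estimate M @^-1` Re_entry_pos (e j.+1) (e 0%N).

Definition wrong_sign (s : bool) (j : nat) : set (outcome M) :=
  if s then ~` predicted_pos j else predicted_pos j.

Lemma basis_hnorm j : hnorm (e j) = 1.
Proof. by rewrite /hnorm he.1 eqxx sqrtr1. Qed.

Lemma measurable_predicted_pos j : measurable (predicted_pos j).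
Proof.
apply: estimate_measurable; apply: borel_Re_entry_pos he.1 he.2 _ _ _ _;
  exact: basis_hnorm.
Qed.

Lemma measurable_wrong_sign s j : measurable (wrong_sign s j).
Proof.
by case: s; rewrite /wrong_sign; try apply: measurableC;
  exact: measurable_predicted_pos.
Qed.

(** [M E] being self-adjoint, [rho^n M E] is the rank-one map [u |-> <M E Psi|u> Psi], whose trace
    is given by Parseval. *)
Lemma outcome_lawE psi E : measurable E -> outcome_law M (ketbra psi) E =
  (complex.Re (braket (tens K (fun=> psi))
     (measurement M E (tens K (fun=> psi)))))%:E.
Proof.
move=> mE; have pM := measurement_povm M; rewrite /outcome_law tensor_opE.
set Psi := tens K _.
have sM := positive_op_selfadjoint (povm_linear pM mE) (povm_positive pM mE).
rewrite (_ : _ \o _ = fun u => braket (measurement M E Psi) u *: Psi);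
  last first.
  by apply/funext => u; rewrite /= /ketbra sM.
rewrite (traceE (has_trace_rank1 (v := measurement M E Psi) (w := Psi)
  (tensor_basis_orthonormal K he) (tensor_basis_dense he))).
by rewrite sM.
Qed.

Variable dist : (H -> H) -> (H -> H) -> R.
Hypothesis dist_ge : forall phi psi u : H,
  hnorm phi = 1 -> hnorm psi = 1 -> hnorm u = 1 ->
  hnorm (ketbra phi u - ketbra psi u) ^+ 2 <=
  dist (ketbra phi) (ketbra psi) ^+ 2.

(* An entry predicted with the wrong sign is off by at least [r]; Bessel adds
   up these errors over the entries. *)
Lemma risk_ge psi (N : nat) (s : nat -> bool) (r : R) :
  hnorm psi = 1 -> 0 <= r ->
  (forall j, (j < N)%N -> complex.Re (braket (e j.+1) (ketbra psi (e 0%N))) =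
     if s j then r else - r) ->
  ((\sum_(j < N) r ^+ 2 * complex.Re (braket (tens K (fun=> psi))
      (measurement M (wrong_sign (s j) j) (tens K (fun=> psi)))))%:E
   <= risk dist M (ketbra psi))%E.
Proof.
move=> n1 r0 hs.
have [m hm] := born_measure (measurement_povm M) (tens K (fun=> psi)).
rewrite /risk (eq_integral_measurable (m := m)); last first.
  by move=> E mE; rewrite outcome_lawE // hm.
rewrite -sumEFin.
rewrite (eq_bigr (fun j : 'I_N => (r ^+ 2)%:E * m (wrong_sign (s j) j))%E);
  last by move=> j _; rewrite hm ?EFinM //; exact: measurable_wrong_sign.
apply: (@integral_ge_indic_sum _ _ _ m _ (fun j => wrong_sign (s j) j))
  => [j| |t];
  [exact: measurable_wrong_sign|exact: sqr_ge0|].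
have [phi [n2 Ephi]] := estimate_pure t.
rewrite Ephi; apply: le_trans (dist_ge n2 n1 (basis_hnorm 0)).
set D := _ - _; have ob : uniq [seq j.+1 | j <- iota 0 N].
  by rewrite map_inj_uniq ?iota_uniq // => ? ? [].
apply: le_trans (bessel he.1 D ob); rewrite big_map -[N in iota 0 N]subn0.
rewrite -/(index_iota 0 N) big_mkord; apply: ler_sum => j _.
rewrite indicE; case: (boolP (t \in _)) => [/set_mem w|_];
  last by rewrite mulr0 sqr_ge0.
rewrite mulr1.
apply: le_trans (_ : complex.Re (braket (e j.+1) D) ^+ 2 <= _); last first.
  by rewrite normc_sqr lerDl sqr_ge0.
rewrite /D braketBr ReD ReN hs //.
set x := complex.Re _; have pE : predicted_pos j t <->
    pure_states (ketbra phi) /\ 0 < x.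
  by rewrite /predicted_pos /preimage /= Ephi.
move: w; rewrite /wrong_sign; case: (s j) => [w|/pE[_ w]]; last first.
  by rewrite opprK ler_sqr ?nnegrE; lra.
have x0 : x <= 0.
  rewrite leNgt; apply/negP => x0; apply: w; apply/pE.
  by split => //; exists phi.
by rewrite -[leRHS]sqrrN ler_sqr ?nnegrE; lra.
Qed.

End model.
End Risk.

(** * Sign flips and test states *)

Section Assouad.
Local Open Scope classical_set_scope.
Local Open Scope complex_scope.
Local Open Scope ring_scope.

Variable R : realType.

Definition flip N (i : 'I_N) (x : {ffun 'I_N -> bool}) : {ffun 'I_N -> bool} :=
  [ffun j => (j == i) (+) x j].

Lemma flipK N (i : 'I_N) : involutive (flip i).
Proof. by move=> x; apply/ffunP => j; rewrite !ffunE addKb. Qed.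

(** Some vertex reaches the average over the cube. For fixed [i] the flip permutes the cube, so
    [f x i] may be averaged with [f (flip i x) i], giving at least [k / 2]. *)
Lemma assouad N (f : {ffun 'I_N -> bool} -> 'I_N -> R) (k : R) :
  (forall x i, k <= f x i + f (flip i x) i) ->
  exists x, N%:R * (k / 2) <= \sum_i f x i.
Proof.
move=> hf; apply/not_existsP => h.
have {}h x : \sum_i f x i < N%:R * (k / 2) by rewrite ltNge; apply/negP/h.
have lt : \sum_x \sum_i f x i < \sum_(x : {ffun 'I_N -> bool}) N%:R * (k / 2).
  (* Strictness survives summation because the cube is nonempty, even for [N = 0]. *)
  apply: ltr_sum => //; apply/hasP; exists [ffun=> true];
    by rewrite ?mem_index_enum.
suff : \sum_(x : {ffun 'I_N -> bool}) N%:R * (k / 2) <= \sum_x \sum_i f x i.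
  by rewrite leNgt lt.
rewrite exchange_big /=.
have -> : \sum_(x : {ffun 'I_N -> bool}) N%:R * (k / 2) =
    \sum_(i < N) \sum_(x : {ffun 'I_N -> bool}) k / 2.
  rewrite exchange_big /=; apply: eq_bigr => x _.
  by rewrite sumr_const card_ord mulr_natl.
apply: ler_sum => i _.
have e : \sum_x f x i = \sum_x f (flip i x) i.
  by rewrite (reindex_inj (inv_inj (@flipK _ i))).
have -> : \sum_x f x i = \sum_x (f x i + f (flip i x) i) / 2.
  by rewrite -mulr_suml big_split /= -e; lra.
by apply: ler_sum => x _; rewrite ler_pM2r // invr_gt0.
Qed.

Section states.
Variables (H : preHilbert R) (e : nat -> H).
Hypothesis he : orthonormal_basis e.

Definition vec (m : nat) (x : nat -> R) : H := \sum_(j < m) (x j)%:C *: e j.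

Lemma braket_basis_vec m x j :
  braket (e j) (vec m x) = (if (j < m)%N then x j else 0)%:C.
Proof.
rewrite /vec braket_sumr; case: ifPn => jm.
  rewrite (bigD1 (Ordinal jm)) //= braketZr he.1 eqxx mulr1.
  rewrite big1 ?addr0 // => i ij.
  rewrite braketZr he.1; case: eqP => [ji|_]; last by rewrite mulr0.
  by rewrite -val_eqE /= ji eqxx in ij.
rewrite big1 // => i _; rewrite braketZr he.1; case: eqP => [ji|_].
  by rewrite ji ltn_ord in jm.
by rewrite mulr0.
Qed.

Lemma braket_vec m x y :
  braket (vec m x) (vec m y) = (\sum_(j < m) x j * y j)%:C.
Proof.
rewrite {1}/vec braket_suml rmorph_sum; apply: eq_bigr => j _.
by rewrite braketZl braket_basis_vec ltn_ord conjcRC rmorphM.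
Qed.

Lemma hnorm_vec m (x : nat -> R) :
  \sum_(j < m) x j ^+ 2 = 1 -> hnorm (vec m x) = 1.
Proof.
move=> h; rewrite /hnorm braket_vec /=.
by under eq_bigr do rewrite -expr2; rewrite h sqrtr1.
Qed.

Lemma sobolev_vec m (x : nat -> R) (alpha L : R) : \sum_(j < m) x j ^+ 2 = 1 ->
  \sum_(j < m) x j ^+ 2 * (j%:R `^ (2 * alpha)) <= L ->
  sobolev e alpha L (ketbra (vec m x)).
Proof.
move=> h1 hL; exists (vec m x); split => //; last exact: hnorm_vec.
apply: le_trans (_ : (\sum_(j < m) x j ^+ 2 * (j%:R `^ (2 * alpha)))%:E <= _)%E;
  last by rewrite lee_fin.
(* The coefficients vanish from index [m] on, so the partial sums are eventually constant. *)
rewrite le_eqVlt; apply/orP; left; apply/eqP; apply: lim_near_cst.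
  exact: ereal_hausdorff.
exists m => // N /= mN; rewrite (big_cat_nat (leq0n m) mN) /=.
rewrite [X in (_ + X)%E]big_nat_cond [X in (_ + X)%E]big1; last first.
  move=> j; rewrite andbT => /andP[mj _].
  by rewrite braket_basis_vec ltnNge mj /= expr0n /= addr0 sqrtr0 expr0n mul0r.
rewrite adde0 big_mkord -sumEFin; apply: eq_bigr => j _.
by rewrite braket_basis_vec ltn_ord normc_realC real_normK ?num_real.
Qed.

End states.
End Assouad.

(** * Minimax lower bound *)

Section LowerBound.
Local Open Scope classical_set_scope.
Local Open Scope complex_scope.
Local Open Scope ring_scope.

Variable R : realType.

Lemma bernoulli_ineq (x : R) n : 0 <= x <= 1 -> 1 - n%:R * x <= (1 - x) ^+ n.
Proof.
move=> /andP[x0 x1]; elim: n => [|n ih]; first by rewrite mul0r subr0 expr0.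
rewrite exprS; apply: le_trans (ler_wpM2l _ ih); last by rewrite subr_ge0.
have n0 : 0 <= n%:R :> R by [].
rewrite -natr1; have := mulr_ge0 n0 (sqr_ge0 x); nra.
Qed.

Lemma limn_einf_ge (u : nat -> \bar R) (l : \bar R) :
  (forall n, (0 < n)%N -> (l <= u n)%E) -> (l <= limn_einf u)%E.
Proof.
move=> h; rewrite limn_einf_lim; apply: lime_ge; first exact: is_cvg_einfs.
exists 1%N => // n /= n1; apply: le_ereal_inf_tmp => _ [k /= nk <-].
by apply: h; apply: leq_trans nk.
Qed.

Definition rate (alpha : R) := 2 * alpha / (2 * alpha + 1).

(* Take the integer part of [n ^ (1 / (2 alpha + 1))]. *)
Lemma dimension_choice (alpha : R) (n : nat) : 0 < alpha -> (0 < n)%N ->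
  exists N : nat, [/\ N%:R <= n%:R :> R,
    N%:R * N%:R `^ (2 * alpha) <= n%:R
  & n%:R <= 2 * N%:R * n%:R `^ rate alpha].
Proof.
move=> al0 n0; have n1 : 1 <= n%:R :> R by rewrite ler1n.
have np : 0 < n%:R :> R by rewrite ltr0n.
have d0 : 0 < 2 * alpha + 1 by rewrite ltr_wpDl // mulr_ge0 // ltW.
pose b : R := (2 * alpha + 1)^-1; pose x := n%:R `^ b.
have b0 : 0 <= b by rewrite invr_ge0 ltW.
have b1 : b <= 1 by rewrite invf_le1 // lerDr mulr_ge0 // ltW.
have x1 : 1 <= x by rewrite -(powRr0 n%:R) ler_powR.
have x0 : 0 <= x by apply: le_trans x1.
have xn : x <= n%:R by rewrite -[leRHS]powRr1 ?ler_powR // ltW.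
have [Nx xN] := andP (truncn_itv x0).
exists (Num.trunc x); move: (Num.trunc x) Nx xN => N Nx xN.
have xx : x * x `^ (2 * alpha) = n%:R.
  rewrite -{1}(powRr1 x0) -powRD addrC; last by rewrite gt_eqF.
  by rewrite /x -powRrM mulVf ?powRr1 ?gt_eqF // ltW.
split.
- exact: le_trans Nx xn.
- rewrite -xx; apply: ler_pM; rewrite ?powR_ge0 //.
  by apply: ge0_ler_powR; rewrite ?nnegrE // mulr_ge0 // ltW.
(* Here [x ^ (2 alpha) = n ^ rate], and [x < N + 1 <= 2 N] because [N >= 1]. *)
- have {1}-> : n%:R = x * n%:R `^ rate alpha :> R.
    by rewrite -{1}xx; congr (_ * _); rewrite /x -powRrM mulrC.
  apply: ler_wpM2r; first exact: powR_ge0.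
  have N1 : 1 <= N%:R :> R.
    by rewrite ler1n lt0n; apply: contraTneq xN => ->; rewrite -leNgt.
  by apply: ltW; apply: lt_le_trans xN _; rewrite -natr1; lra.
Qed.

Section minimax.
Variables (alpha L : R).
Hypotheses (halpha : 0 < alpha) (hL : 0 < L).
Variables (H : hilbert R) (e : nat -> H).
Hypothesis he : orthonormal_basis e.
Variables (n : nat) (K : tensor_power H n).
Hypothesis n0 : (0 < n)%N.
Variable dist : (H -> H) -> (H -> H) -> R.
Hypothesis dist_ge : forall phi psi u : H,
  hnorm phi = 1 -> hnorm psi = 1 -> hnorm u = 1 ->
  hnorm (ketbra phi u - ketbra psi u) ^+ 2 <=
  dist (ketbra phi) (ketbra psi) ^+ 2.

(** With [b = min (1/4) L]: testing gives 1/8 per pair of flipped states, hence 1/16 per sign on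
    average; [n ^ rate * N * delta ^ 2 >= b / 2]; and [a ^ 2 >= 3/4]. The product [3 b / 128]
    exceeds [b / 64]. *)
Lemma minimax_risk_ge :
  ((Num.min 4^-1 L / 64)%:E <= minimax_risk e K dist alpha L)%E.
Proof.
set b := Num.min _ _.
have b0 : 0 < b by rewrite lt_min hL invr_gt0 ltr0n.
have b4 : b <= 4^-1 by rewrite ge_min lexx.
have bL : b <= L by rewrite ge_min lexx orbT.
have np : 0 < n%:R :> R by rewrite ltr0n.
have n1 : 1 <= n%:R :> R by rewrite ler1n.
have [N [Nn Nal nN]] := dimension_choice halpha n0.
pose d2 : R := b / n%:R; have d20 : 0 < d2 by rewrite divr_gt0.
have d2b : n%:R * d2 = b by rewrite mulrC divfK // gt_eqF.
have d2l : d2 <= b by rewrite ler_pdivrMr // ler_peMr // ltW.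
have Nd : N%:R * d2 <= 4^-1.
  by apply: le_trans b4; rewrite -d2b ler_wpM2r // ltW.
pose delta := Num.sqrt d2; pose a := Num.sqrt (1 - N%:R * d2).
have dd : delta ^+ 2 = d2 by rewrite sqr_sqrtr // ltW.
have aa : a ^+ 2 = 1 - N%:R * d2 by rewrite sqr_sqrtr //; lra.
have [dge0 age0] : 0 <= delta /\ 0 <= a by split; exact: sqrtr_ge0.
pose s (x : {ffun 'I_N -> bool}) j := oapp x false (insub j).
have sE x (i : 'I_N) : s x i = x i by rewrite /s valK.
pose co x j := if j is j'.+1 then (if s x j' then delta else - delta) else a.
have coS x j : co x j.+1 = if s x j then delta else - delta by [].
pose psi x := vec e N.+1 (co x).
have sq x : \sum_(j < N.+1) co x j ^+ 2 = 1.
  rewrite big_ord_recl /= aa.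
  rewrite (eq_bigr (fun=> d2)) => [|j _]; last first.
    by rewrite /= -coS coS; case: (s x j); rewrite ?sqrrN dd.
  by rewrite sumr_const card_ord -(mulr_natl d2) subrK.
have hpsi x : hnorm (psi x) = 1 by exact: hnorm_vec.
have sob x : sobolev e alpha L (ketbra (psi x)).
  apply: sobolev_vec => //; apply: le_trans bL.
  (* The reference coefficient has weight [0 ^ (2 alpha) = 0]; the others contribute at most [delta
     ^ 2 * N * N ^ (2 alpha) <= n * delta ^ 2 = b]. *)
  rewrite big_ord_recl /= powR0 ?mulf_neq0 ?gt_eqF // mulr0 add0r.
  apply: le_trans (_ : \sum_(j < N) d2 * N%:R `^ (2 * alpha) <= _).
    apply: ler_sum => j _; rewrite /= -coS coS.
    have -> : (if s x j then delta else - delta) ^+ 2 = d2.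
      by case: (s x j); rewrite ?sqrrN dd.
    rewrite ler_wpM2l ?(ltW d20) //; apply: ge0_ler_powR; rewrite ?nnegrE //.
      by rewrite mulr_ge0 // ltW.
    by rewrite ler_nat.
  rewrite sumr_const card_ord -(mulr_natl (_ * _)) mulrCA -d2b mulrC.
  rewrite ler_wpM2r //.
  exact: ltW.
have ent x j : (j < N)%N ->
    complex.Re (braket (e j.+1) (ketbra (psi x) (e 0%N))) =
    if s x j then a * delta else - (a * delta).
  move=> jN; rewrite /ketbra braketZr braketC !braket_basis_vec //= ltnS jN.
  by rewrite oppr0 mul0r subr0; case: (s x j); rewrite ?mulrN.
(* The flip turns one term [delta ^ 2] of the squared norm 1 into [- delta ^ 2]. *)
have fl x i : braket (psi x) (psi (flip i x)) = (1 - 2 * d2)%:C.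
  rewrite braket_vec //; congr (_%:C); rewrite big_ord_recl /= -expr2 aa.
  rewrite (bigD1 i) //= (eq_bigr (fun=> d2)) => [|j ji]; last first.
    rewrite !sE ffunE (negbTE ji) /=.
    by case: (x j); rewrite ?mulrNN -expr2 dd.
  rewrite sumr_const cardC1 card_ord !sE ffunE eqxx /=.
  have -> : (if x i then delta else - delta) *
      (if ~~ x i then delta else - delta) = - d2.
    by case: (x i); rewrite ?mulrN ?mulNr -expr2 dd.
  have Np : (0 < N)%N by case: (N) i => [[]|].
  by rewrite -(mulr_natl d2) -subn1 natrB //; lra.
apply: le_ereal_inf_tmp => _ [M ->].
pose Psi x := tens K (fun=> psi x).
have hPsi x : hnorm (Psi x) = 1 by rewrite hnorm_tens big1.
pose f x (i : 'I_N) := complex.Re (braket (Psi x)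
  (measurement M (wrong_sign (M := M) (s x i) i) (Psi x))).
have [x hx] : exists x, N%:R * (8^-1 / 2) <= \sum_i f x i.
  apply: assouad => x i; rewrite /f !sE ffunE eqxx /=.
  have g : 8^-1 <= normc (braket (Psi x) (Psi (flip i x))) ^+ 2 / 2.
    rewrite tens_braket (eq_bigr (fun=> (1 - 2 * d2)%:C)) => [|k _];
      last exact: fl.
    rewrite prodr_const card_ord -rmorphXn /= -/(normc _).
    (* Bernoulli gives [1 - 2 n delta ^ 2 = 1 - 2 b >= 1/2]: this is why [delta ^ 2] scales as
       [1 / n] and [b <= 1/4]. *)
    have h : 2^-1 <= (1 - 2 * d2) ^+ n.
      apply: le_trans (bernoulli_ineq n _); last by apply/andP; split; lra.
      by rewrite mulrCA d2b; lra.
    rewrite expr0n /= addr0 sqrtr_sqr real_normK ?num_real //.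
    have : 2^-1 ^+ 2 <= ((1 - 2 * d2) ^+ n) ^+ 2 :> R.
      by rewrite ler_sqr ?nnegrE //; apply: le_trans h.
    by rewrite expr2; lra.
  (* The wrong events for [x] and for [flip i x] are complementary, so the two errors are those of a
     single test between the two states. *)
  apply: le_trans g _; have mE := measurable_predicted_pos he M i.
  case: (x i); rewrite /wrong_sign /=.
    have := povm_testing (measurement_povm M) (measurableC mE) (hPsi x)
      (hPsi (flip i x)).
    by rewrite setCK.
  exact: (povm_testing (measurement_povm M) mE (hPsi x) (hPsi (flip i x))).
apply: le_trans (ereal_sup_ubound _); last by exists (ketbra (psi x)).
have ad0 : 0 <= a * delta by rewrite mulr_ge0.
have hr := risk_ge he M dist_ge (hpsi x) ad0 (ent x).
apply: le_trans (lee_wpmul2l _ hr); last by rewrite lee_fin powR_ge0.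
rewrite -EFinM lee_fin -mulr_sumr exprMn aa dd -/(rate alpha).
set P := n%:R `^ rate alpha in nN *; have P0 : 0 <= P by exact: powR_ge0.
rewrite -/(f x); set S := \sum_i f x i in hx *.
(* The choice of [N] pays off: [n ^ rate * N >= n / 2] cancels the [1 / n] in [d2]. *)
have NPd : b / 2 <= P * d2 * N%:R.
  by have := ler_wpM2r (ltW d20) nN; rewrite d2b; lra.
have NPd0 : 0 <= P * d2 by rewrite mulr_ge0 // ltW.
have S0 : P * d2 * (N%:R * (8^-1 / 2)) <= P * d2 * S by rewrite ler_wpM2l.
have PS0 : 0 <= P * d2 * S.
  by apply: le_trans S0; rewrite mulr_ge0 // mulr_ge0.
have -> : P * ((1 - N%:R * d2) * d2 * S) = (1 - N%:R * d2) * (P * d2 * S)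
  by ring.
apply: le_trans (_ : 3 / 4 * (P * d2 * S) <= _); first by lra.
by rewrite ler_wpM2r //; lra.
Qed.

End minimax.
End LowerBound.

Local Open Scope ring_scope.

Theorem theorem5p3 (R : realType) (alpha L : R) (halpha : 0 < alpha)
    (hL : 0 < L) :
  exists c : R, 0 < c /\
    forall (H : hilbert R) (e : nat -> H) (he : orthonormal_basis e)
      (K : forall n : nat, tensor_power H n),
      (c%:E <= limn_einf
         (fun n => minimax_risk e (K n) (trace_dist e) alpha L))%E /\
      (c%:E <= limn_einf
         (fun n => minimax_risk e (K n) (bures_dist e) alpha L))%E.
Proof.
exists (Num.min 4^-1 L / 64); split.
  by rewrite divr_gt0 // lt_min hL invr_gt0 ltr0n.
move=> H e he K; split; apply: limn_einf_ge => n n0;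
  apply: minimax_risk_ge => // phi psi u n1 n2 u1.
- exact: hnorm_ketbra_diff_le_trace_dist n1 n2 _ _ he.1 he.2 _ u1.
- exact: hnorm_ketbra_diff_le_bures_dist n1 n2 _ _ he.1 he.2 _ u1.
Qed.
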